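(* The commensurator of $\vec T$ in $T$ is $\vec T$; that is, $\{t\in T \mid t\vec Tt^{-1}\cap\vec T \text{ has finite index in both } \vec T \text{ and } t\vec Tt^{-1}\}=\vec T$.
   Context: **Trees and $T$.** A full binary tree is a finite rooted plane tree in which every vertex has either $0$ children or $2$ children (a left and a right one); leaves are numbered $1,2,\dots$ from left to right. Associate $[0,1)$ with the root, and if $[a,b)$ is associated with a vertex, associate $[a,\frac{a+b}2)$ with its left child and $[\frac{a+b}2,b)$ with its right child. Given full binary trees $R,S$ with the same number $m$ of leaves and $1\le n\le m$, the triple $(R,S,n)$ represents the homeomorphism of the circle $[0,1]/(0\sim 1)$ which, for each $i$, maps the interval of leaf $i$ of $R$ affinely and increasingly onto the interval of leaf $i+n-1$ (taken mod $m$ in $\{1,\dots,m\}$) of $S$; leaf $i$ of $R$ is said to be identified with leaf $i+n-1$ of $S$. Thompson's group $T$ is the group of all homeomorphisms so represented. A triple is reduced if there is no caret in $R$ both of whose children are leaves that are identified (left with left, right with right) with the two leaf children of a caret of $S$; every element of $T$ has a unique reduced triple. **Thompson graphs.** For a full binary tree with leaves $l_1,\dots,l_m$ arranged on a horizontal line, its Thompson graph has vertices $v_1,\dots,v_m$ on that line, $v_1$ to the left of $l_1$ and $v_i$ between $l_{i-1}$ and $l_i$; for each left edge $e$ of the tree, the unique pair $v_i,v_j$ that can be joined by a path above the line crossing the tree only at $e$ is joined by an edge. (Equivalently: for each non-leaf vertex $p$, join $v_i$ to $v_j$ where $l_i$ is the leftmost leaf below the left child of $p$ and $l_j$ is the leftmost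 leaf below the right child of $p$.) The Thompson graph of $f\in T$ with reduced triple $(R,S,n)$ is obtained from the Thompson graphs of $R$ and $S$ by identifying their vertices in the same way as the leaves (the $i$th vertex for $R$ with the $(i+n-1)$st, mod $m$, for $S$). $\vec T$ is the subgroup of all $f\in T$ whose Thompson graph is bipartite. *)

(* Defs.v *)
From HB Require Import structures.
From mathcomp Require Import all_boot all_order all_algebra.
From mathcomp Require Import boolp classical_sets cardinality reals.

Set Implicit Arguments.
Unset Strict Implicit.
Unset Printing Implicit Defensive.

Import Order.TTheory GRing.Theory Num.Theory.

Local Open Scope classical_set_scope.

(* H and K stand for subgroups of G with K contained in H: the index |H : K| is
   the number of left cosets h K with h in H. *)
Definition finite_index (G : groupType) (H K : set G) : Prop :=
  finite_set [set [set (h * k)%g | k in K] | h in H].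

Definition conj_set (G : groupType) (t : G) (H : set G) : set G :=
  [set (t * h * t^-1)%g | h in H].

Definition commensurator (G : groupType) (T H : set G) : set G :=
  [set t | T t /\
     finite_index H (conj_set t H `&` H) /\
     finite_index (conj_set t H) (conj_set t H `&` H)].

Local Open Scope ring_scope.

(* The circle [0,1]/(0 ~ 1): each of its points has exactly one representative
   in [0,1). *)
Definition circle (R : realType) : Type := {x : R | 0 <= x < 1}.

(* The ambient group is that of all bijections of the circle, under composition
   (f * g = f \o g). Continuity is not imposed: the elements of Thompson's group
   T are cut out below by explicit formulas that make them homeomorphisms. *)
Record circle_perm (R : realType) := CirclePerm {
  cp_fun :> circle R -> circle R;
  cp_inv : circle R -> circle R;
  cp_funK : cancel cp_fun cp_inv;
  cp_invK : cancel cp_inv cp_fun }.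

Lemma circle_permP (R : realType) (f g : circle_perm R) : f =1 g -> f = g.
Proof.
case: f g => [f f' fK f'K] [g g' gK g'K] /= /funext efg; subst g.
have e : f' = g' by apply/funext => x; rewrite -[in LHS](g'K x) fK.
by subst g'; congr CirclePerm; apply: Prop_irrelevance.
Qed.

Section CirclePermGroup.
Variable R : realType.
Implicit Types f g h : circle_perm R.

HB.instance Definition _ := gen_eqMixin (circle_perm R).
HB.instance Definition _ := gen_choiceMixin (circle_perm R).

Definition cp_one : circle_perm R :=
  @CirclePerm R id id (fun=> erefl) (fun=> erefl).

Definition cp_mul f g : circle_perm R :=
  CirclePerm (can_comp (@cp_funK R f) (@cp_funK R g))
             (can_comp (@cp_invK R g) (@cp_invK R f)).

Definition cp_invg f : circle_perm R :=
  CirclePerm (@cp_invK R f) (@cp_funK R f).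

Fact cp_mulA : associative cp_mul.
Proof. by move=> f g h; apply: circle_permP. Qed.

Fact cp_mul1 : left_id cp_one cp_mul.
Proof. by move=> f; apply: circle_permP. Qed.

Fact cp_1mul : right_id cp_one cp_mul.
Proof. by move=> f; apply: circle_permP. Qed.

Fact cp_mulV : left_inverse cp_one cp_invg cp_mul.
Proof. by move=> f; apply: circle_permP => x /=; rewrite cp_funK. Qed.

Fact cp_Vmul : right_inverse cp_one cp_invg cp_mul.
Proof. by move=> f; apply: circle_permP => x /=; rewrite cp_invK. Qed.

HB.instance Definition _ :=
  isGroup.Build (circle_perm R) cp_mulA cp_mul1 cp_1mul cp_mulV cp_Vmul.

End CirclePermGroup.

Inductive btree := Leaf | Node of btree & btree.

Fixpoint nleaves (t : btree) : nat :=
  if t is Node l r then (nleaves l + nleaves r)%N else 1%N.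

(* The intervals [p.1, p.2) of the leaves of t, from left to right, when [a, b)
   is the interval of the root. *)
Fixpoint leaf_intervals (R : realType) (a b : R) (t : btree) : seq (R * R) :=
  if t is Node l r then
    leaf_intervals a ((a + b) / 2) l ++ leaf_intervals ((a + b) / 2) b r
  else [:: (a, b)].

Definition leaf_interval (R : realType) (t : btree) (i : nat) : R * R :=
  nth (0, 0) (leaf_intervals 0 1 t) i.

Record tree_triple := TreeTriple {
  src : btree;
  tgt : btree;
  shift : nat;
  nleaves_tgt : nleaves tgt = nleaves src;
  shift_bounds : (1 <= shift <= nleaves src)%N }.

(* Leaves and vertices are numbered from 0, so leaf i + 1 being identified with
   leaf (i + 1) + n - 1 becomes i |-> i + (n - 1) modulo the number of leaves. *)
Definition ident (p : tree_triple) (i : nat) : nat :=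
  ((i + (shift p).-1) %% nleaves (src p))%N.

Definition represents (R : realType) (p : tree_triple) (f : circle_perm R) :
    Prop :=
  forall i : nat, (i < nleaves (src p))%N ->
    let I := leaf_interval R (src p) i in
    let J := leaf_interval R (tgt p) (ident p i) in
    forall x : circle R, I.1 <= val x < I.2 ->
      val (f x) = J.1 + (val x - I.1) * ((J.2 - J.1) / (I.2 - I.1)).

Definition thompson_T (R : realType) : set (circle_perm R) :=
  [set f | exists p : tree_triple, represents p f].

(* The indices of the left leaves of the carets of t whose two children are
   leaves, when the leftmost leaf of t has index k. *)
Fixpoint leaf_carets (k : nat) (t : btree) : seq nat :=
  match t with
  | Leaf => [::]
  | Node Leaf Leaf => [:: k]
  | Node l r => leaf_carets k l ++ leaf_carets (k + nleaves l)%N r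
  end.

Definition reduced (p : tree_triple) : Prop :=
  ~ exists i j : nat,
      [/\ i \in leaf_carets 0 (src p), j \in leaf_carets 0 (tgt p),
          ident p i = j & ident p i.+1 = j.+1].

(* The edges of the Thompson graph of t, one for each non-leaf vertex, when the
   leftmost leaf of t has index k. *)
Fixpoint tree_edges (k : nat) (t : btree) : seq (nat * nat) :=
  if t is Node l r then
    (k, (k + nleaves l)%N) :: tree_edges k l ++ tree_edges (k + nleaves l)%N r
  else [::].

Definition tree_adj (t : btree) (i j : nat) : bool :=
  ((i, j) \in tree_edges 0 t) || ((j, i) \in tree_edges 0 t).

(* The vertex i stands for vertex i of the Thompson graph of src p and for vertex
   ident p i of that of tgt p. Multiple edges are irrelevant to bipartiteness and
   are not recorded. *)
Definition thompson_graph (p : tree_triple) : rel 'I_(nleaves (src p)) :=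
  fun i j => tree_adj (src p) i j || tree_adj (tgt p) (ident p i) (ident p j).

Definition bipartite (V : finType) (e : rel V) : Prop :=
  exists A : {set V}, forall x y : V, e x y -> (x \in A) != (y \in A).

Definition vec_T (R : realType) : set (circle_perm R) :=
  [set f | exists p : tree_triple,
     [/\ represents p f, reduced p & bipartite (@thompson_graph p)]].

(* Main.v *)
(* In a Thompson graph the edges of one tree join leaves whose left endpoints
   have binary digit sums of opposite parities, and they connect all leaves.  So
   f in T lies in vec T exactly when f either preserves or reverses the parity
   of the digit sum s(x) of every dyadic x.

   Let t commensurate vec T.  The function d(x) = s(t^-1 x) + s(x) mod 2 is
   constant on the leaf intervals of a triple for t^-1, in particular near 0 on
   the right.  The element h of vec T given by 0 -> 00, 10 -> 010, 110 -> 011,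
   111 -> 1 fixes 0 and moves every point of (0, 1) towards 0.  By the
   pigeonhole principle some positive power h^n lies in t vec T t^-1, hence
   changes d by a constant, which is 0 because h fixes 0.  Since h^(nN) x tends
   to 0, d(x) = d(0) for all dyadic x, which says that t lies in vec T. *)
Require Import Defs.
From mathcomp Require Import all_boot all_order all_algebra.
From mathcomp Require Import boolp classical_sets cardinality reals.
From mathcomp Require Import zify ring lra.

Set Implicit Arguments.
Unset Strict Implicit.
Unset Printing Implicit Defensive.

Import Order.TTheory GRing.Theory Num.Theory.

Local Open Scope ring_scope.

(** * Binary words, leaf addresses and caret expansions *)

Definition parity (w : seq bool) : bool := foldr addb false w.

Lemma parity_cat u w : parity (u ++ w) = parity u (+) parity w.
Proof. by elim: u => //= b u ->; rewrite addbA. Qed.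

Lemma parity_nseq n : parity (nseq n false) = false.
Proof. by elim: n. Qed.

(* [cyl u] is the increasing affine map of [0, 1) onto the interval of the
   vertex whose address is [u] (false is left, true is right); [cyl u 0] is the
   dyadic number with binary digits [u]. *)
Fixpoint cyl (R : realType) (u : seq bool) (y : R) : R :=
  if u is b :: u' then (b%:R + cyl u' y) / 2 else y.

Fixpoint leaf_word (t : btree) (i : nat) : seq bool :=
  if t is Node l r then
    if (i < nleaves l)%N then false :: leaf_word l i
    else true :: leaf_word r (i - nleaves l)
  else [::].

(** Hangs a caret on leaf [i]; cancelling a common caret of a triple undoes this in both trees. *)
Fixpoint expand (t : btree) (i : nat) : btree :=
  if t is Node l r then
    if (i < nleaves l)%N then Node (expand l i) r
    else Node l (expand r (i - nleaves l))
  else Node Leaf Leaf.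

Lemma nleaves_gt0 t : (0 < nleaves t)%N.
Proof. by elim: t => //= l IHl r IHr; rewrite addn_gt0 IHl. Qed.

Lemma nleaves_expand t i : nleaves (expand t i) = (nleaves t).+1.
Proof.
elim: t i => //= l IHl r IHr i.
by case: ifP => _ /=; rewrite ?IHl ?IHr ?addnS.
Qed.

Lemma leaf_word_expand t i k : (i < nleaves t)%N -> (k <= nleaves t)%N ->
  leaf_word (expand t i) k =
    if (k < i)%N then leaf_word t k
    else if k == i then rcons (leaf_word t i) false
    else if k == i.+1 then rcons (leaf_word t i) true
    else leaf_word t k.-1.
Proof.
elim: t i k => [|l IHl r IHr] i k.
  by rewrite /= ltnS leqn0 => /eqP->; case: k => [|[|k]].
move=> /= lti lek; case: (ltnP i (nleaves l)) => il /=.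
  rewrite nleaves_expand ltnS; case: (leqP k (nleaves l)) => kl.
    rewrite IHl //; case: (ltnP k i) => ki; first by rewrite (ltn_trans ki il).
    case: eqP => // ki'; case: eqP => // ki''.
    by have -> : (k.-1 < nleaves l)%N by lia.
  have -> : (k < i)%N = false by lia.
  have -> : (k == i)%N = false by lia.
  have -> : (k == i.+1)%N = false by lia.
  have -> : (k.-1 < nleaves l)%N = false by lia.
  by congr (_ :: leaf_word _ _); lia.
case: (ltnP k (nleaves l)) => kl.
  by have -> : (k < i)%N by lia.
rewrite IHr; [|lia|lia].
have -> : (k - nleaves l < i - nleaves l)%N = (k < i)%N by lia.
have -> : (k - nleaves l == i - nleaves l)%N = (k == i)%N by lia.
have -> : (k - nleaves l == (i - nleaves l).+1)%N = (k == i.+1)%N by lia.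
case: (ltnP k i) => ki //.
case: eqP => // ki'; case: eqP => // ki''.
have -> : (k.-1 < nleaves l)%N = false by lia.
by congr (_ :: leaf_word _ _); lia.
Qed.

Lemma leaf_caretsP k t j : j \in leaf_carets k t ->
  exists t' i, [/\ j = (k + i)%N, (i < nleaves t')%N & t = expand t' i].
Proof.
elim: t k => //= l IHl r IHr k.
have aux : j \in leaf_carets k l ++ leaf_carets (k + nleaves l) r ->
  exists t' i, [/\ j = (k + i)%N, (i < nleaves t')%N & Node l r = expand t' i].
  rewrite mem_cat => /orP[/IHl|/IHr] [t' [i [-> it ->]]].
    by exists (Node t' r), i; rewrite /= it ltn_addr.
  exists (Node l t'), (nleaves l + i)%N; rewrite /= addnA ltn_add2l it.
  by rewrite ltnNge leq_addr /= addKn.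
case: l aux {IHl} => // aux; case: r aux {IHr} => // aux.
rewrite inE => /eqP ->; exists Leaf, 0; by rewrite addn0.
Qed.

(** * Two-colourings of Thompson graphs *)

Lemma leaf_word0 t : leaf_word t 0 = nseq (size (leaf_word t 0)) false.
Proof. by elim: t => //= l -> r _; rewrite nleaves_gt0 /= !size_nseq. Qed.

(** The edge of the root forces the leftmost leaf of the right subtree to have the colour opposite
    to [chi k], which accounts for the leading digit 1 of the addresses there. *)
Lemma tree_edges_color t k (chi : nat -> bool) :
  (forall i j, (i, j) \in tree_edges k t -> chi i != chi j) ->
  forall i, (i < nleaves t)%N -> chi (k + i)%N = chi k (+) parity (leaf_word t i).
Proof.
elim: t k => [|l IHl r IHr] k /= chiP i.
  by rewrite ltnS leqn0 => /eqP->; rewrite addn0 addbF.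
case: (ltnP i (nleaves l)) => il im.
  by apply: IHl => // a b ab; apply: chiP; rewrite inE mem_cat ab orbT.
have e := chiP _ _ (mem_head _ _).
rewrite -{1}(subnKC il) addnA IHr.
- by move: e => /=; case: (chi k); case: (chi (k + _)%N); case: parity.
- by move=> a b ab; apply: chiP; rewrite inE mem_cat ab !orbT.
- lia.
Qed.

(** The root edge joins the leftmost leaves of the two subtrees, whose addresses are all zeros
    except for the first digit of the right one. *)
Lemma tree_edges_parity t k i j : (i, j) \in tree_edges k t ->
  [/\ (k <= i < k + nleaves t)%N, (k <= j < k + nleaves t)%N
    & parity (leaf_word t (i - k)) != parity (leaf_word t (j - k))].
Proof.
elim: t k => //= l IHl r IHr k; rewrite inE mem_cat => /or3P[/eqP[-> ->]|/IHl|/IHr].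
- have l0 := nleaves_gt0 l; have r0 := nleaves_gt0 r.
  rewrite subnn addKn l0 ltnn subnn /= (leaf_word0 l) (leaf_word0 r) !parity_nseq.
  by split=> //; lia.
- case=> il jl ij.
  have -> : (i - k < nleaves l)%N by lia.
  have -> : (j - k < nleaves l)%N by lia.
  by split=> //; lia.
- case=> il jl ij.
  have -> : (i - k < nleaves l)%N = false by lia.
  have -> : (j - k < nleaves l)%N = false by lia.
  rewrite -!subnDA; split; [lia|lia|].
  by move: ij => /=; case: parity; case: parity.
Qed.

Lemma tree_adj_color t (chi : nat -> bool) :
  (forall i j, (i < nleaves t)%N -> (j < nleaves t)%N -> tree_adj t i j ->
     chi i != chi j) ->
  forall i, (i < nleaves t)%N -> chi i = chi 0%N (+) parity (leaf_word t i).
Proof.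
move=> chiP i it; rewrite -[in LHS](add0n i).
apply: tree_edges_color it => a b ab.
have [al bl _] := tree_edges_parity ab.
by apply: chiP => //; rewrite /tree_adj ab.
Qed.

Lemma tree_adj_parity t i j : tree_adj t i j ->
  parity (leaf_word t i) != parity (leaf_word t j).
Proof.
by case/orP => /tree_edges_parity [_ _]; rewrite !subn0 // eq_sym.
Qed.

Lemma modn_shiftK m s j : (j < m)%N ->
  (((j + (m - s %% m)) %% m + s) %% m)%N = j.
Proof.
move=> jm; have sm : (s %% m <= m)%N by rewrite ltnW // ltn_mod; lia.
by rewrite modnDml -modnDmr -addnA subnK // modnDr modn_small.
Qed.

Lemma modn_shiftVK m s i : (i < m)%N ->
  (((i + s) %% m + (m - s %% m)) %% m)%N = i.
Proof.
move=> im; have sm : (s %% m <= m)%N by rewrite ltnW // ltn_mod; lia.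
by rewrite -(modnDmr i) modnDml -addnA subnKC // modnDr modn_small.
Qed.

(** The only two-colourings of the graph of a tree are the digit parity and its complement, so a
    common one for both trees exists exactly when the parities agree along [ident] up to a
    constant. *)
Lemma bipartite_parity p :
  bipartite (@thompson_graph p) <->
  exists c, forall i, (i < nleaves (src p))%N ->
    parity (leaf_word (tgt p) (ident p i)) = parity (leaf_word (src p) i) (+) c.
Proof.
set m := nleaves (src p).
have m0 : (0 < m)%N by exact: nleaves_gt0.
split=> [[A AP]|[c cP]].
  pose chi i := if insub i is Some x then x \in A else false.
  have chiE (i : 'I_m) : chi i = (i \in A) by rewrite /chi valK.
  (* [rho] inverts [ident], so [chi \o rho] colours the vertices of the target tree. *)
  pose rho j := ((j + (m - (shift p).-1 %% m)) %% m)%N.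
  have rho_lt j : (rho j < m)%N by rewrite ltn_mod.
  have rhoK j : (j < m)%N -> ident p (rho j) = j by exact: modn_shiftK.
  have identK i : (i < m)%N -> rho (ident p i) = i by exact: modn_shiftVK.
  have srcP : forall i, (i < m)%N -> chi i = chi 0%N (+) parity (leaf_word (src p) i).
    apply: tree_adj_color => i j im jm ij.
    rewrite (chiE (Ordinal im)) (chiE (Ordinal jm)); apply: AP.
    by rewrite /thompson_graph ij.
  have tgtP : forall j, (j < nleaves (tgt p))%N ->
      chi (rho j) = chi (rho 0%N) (+) parity (leaf_word (tgt p) j).
    apply: (@tree_adj_color _ (chi \o rho)) => i j.
    rewrite nleaves_tgt => im jm ij /=.
    rewrite (chiE (Ordinal (rho_lt i))) (chiE (Ordinal (rho_lt j))); apply: AP.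
    by rewrite /thompson_graph !rhoK // ij orbT.
  exists (chi 0%N (+) chi (rho 0%N)) => i im.
  have := tgtP (ident p i); rewrite nleaves_tgt ltn_mod m0 identK // srcP //.
  by case: (chi 0%N); case: (chi (rho 0%N)); case: parity; case: parity => // /(_ isT).
exists [set i : 'I_m | parity (leaf_word (src p) i)] => x y; rewrite !inE.
case/orP => /tree_adj_parity //; rewrite !cP //.
by case: c {cP}; case: parity; case: parity.
Qed.

(** * Adding a caret to both trees of a triple *)

Lemma leaf_word_expandE t i : (i < nleaves t)%N ->
  [/\ leaf_word (expand t i) i = rcons (leaf_word t i) false,
      leaf_word (expand t i) i.+1 = rcons (leaf_word t i) true
    & forall k, k != i -> (k < nleaves t)%N ->
        leaf_word (expand t i) (bump i.+1 k) = leaf_word t k].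
Proof.
move=> im; split; first by rewrite leaf_word_expand ?ltnn ?eqxx // ltnW.
  rewrite leaf_word_expand //; have -> : (i.+1 < i)%N = false by lia.
  have -> : (i.+1 == i) = false by lia.
  by rewrite eqxx.
move=> k ki km; rewrite leaf_word_expand; [|lia|rewrite /bump; lia].
rewrite /bump; case: (ltnP i k) => ik.
  rewrite add1n; have -> : (k.+1 < i)%N = false by lia.
  have -> : (k.+1 == i) = false by lia.
  have -> : (k.+1 == i.+1) = false by lia.
  by [].
rewrite add0n; have -> : (k < i)%N by lia.
by [].
Qed.

Lemma modn_lt2 a m : (a < m + m)%N ->
  (a %% m)%N = if (a < m)%N then a else (a - m)%N.
Proof.
move=> am; case: ltnP => H; first by rewrite modn_small.
by rewrite -{1}(subnK H) modnDr modn_small //; lia.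
Qed.

(** [bump i.+1] renumbers the other leaves when leaf [i] splits. Leaf 0 goes to position [k], which
    moves one to the right exactly when leaf [i] wraps around, since its image then lies before
    [k]. *)
Lemma shift_expand m k i : (i < m)%N -> (k < m)%N ->
  let sh a := ((a + k) %% m)%N in
  let sh' a := ((a + if (i + k < m)%N then k else k.+1) %% m.+1)%N in
  [/\ sh' i = sh i, sh' i.+1 = (sh i).+1
    & forall a, a != i -> (a < m)%N ->
        sh a != sh i /\ sh' (bump i.+1 a) = bump (sh i).+1 (sh a)].
Proof.
move=> im km sh sh'.
have shE a : (a < m)%N -> sh a = if (a + k < m)%N then (a + k)%N else (a + k - m)%N.
  by move=> am; rewrite /sh modn_lt2 //; lia.
have sh'E a : (a <= m)%N -> sh' a =
  let b := (a + if i + k < m then k else k.+1)%N in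
  if (b < m.+1)%N then b else (b - m.+1)%N.
  by move=> am; rewrite /sh' modn_lt2 //; case: ifP => _; lia.
rewrite !sh'E ?shE //=; [|lia].
split; [by case: (ltnP (i + k)%N m) => ?; case: ifP; lia
       |by case: (ltnP (i + k)%N m) => ?; case: ifP; lia|] => a ai am.
rewrite sh'E /bump /=; last by case: ltnP; lia.
rewrite shE //; case: (ltnP (i + k)%N m) => ?; case: (ltnP (a + k)%N m) => ?;
  by case: (ltnP i a) => ?; case: ifP => ?; split; lia.
Qed.

(** * Tree pairs acting on the circle *)

Section Thompson.
Variable R : realType.
Implicit Types (f g : circle_perm R) (u w : seq bool) (x y : R) (z : circle R).

Lemma cyl_cat u w y : cyl (u ++ w) y = cyl u (cyl w y).
Proof. by elim: u => //= b u ->. Qed.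

Lemma cyl_ge0_lt1 u y : 0 <= y < 1 -> 0 <= cyl u y < 1.
Proof. by move=> y01; elim: u => //= -[] u IHu /=; lra. Qed.

Lemma cyl_affine u y : cyl u y = cyl u 0 + y * (cyl u 1 - cyl u 0).
Proof. by elim: u => [|b u /= ->] /=; [ring|field]. Qed.

Lemma cyl_width u : (0 : R) < cyl u 1 - cyl u 0.
Proof. by elim: u => [|[] u /= IHu] /=; lra. Qed.

Lemma leaf_intervalsE (a b : R) t i : (i < nleaves t)%N ->
  nth (0, 0) (leaf_intervals a b t) i =
  (a + (b - a) * cyl (leaf_word t i) 0, a + (b - a) * cyl (leaf_word t i) 1).
Proof.
have size_li c d t' : size (leaf_intervals c d t') = nleaves t'.
  by elim: t' c d => //= l IHl r IHr c d; rewrite size_cat IHl IHr.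
elim: t a b i => [|l IHl r IHr] a b i /=.
  by rewrite ltnS leqn0 => /eqP-> /=; congr pair; ring.
rewrite nth_cat size_li; case: (ltnP i (nleaves l)) => il im.
  by rewrite IHl //=; congr pair; field.
by rewrite IHr /=; [congr pair; field|lia].
Qed.

(* [k] stands for n - 1 and matters only modulo the number of leaves. *)
Definition maps_leaves f (s t : btree) (k : nat) : Prop :=
  forall i z y, (i < nleaves s)%N -> 0 <= y < 1 ->
    val z = cyl (leaf_word s i) y ->
    val (f z) = cyl (leaf_word t ((i + k) %% nleaves s)) y.

(** In the coordinate [y] of [0, 1) along each leaf interval, the affine formula says that [y] is
    kept. *)
Lemma representsE p f :
  represents p f <-> maps_leaves f (src p) (tgt p) (shift p).-1.
Proof.
have E t i : (i < nleaves t)%N ->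
    leaf_interval R t i = (cyl (leaf_word t i) 0, cyl (leaf_word t i) 1).
  by move=> it; rewrite /leaf_interval leaf_intervalsE //; congr pair; ring.
have jt i : (ident p i < nleaves (tgt p))%N by rewrite nleaves_tgt ltn_mod nleaves_gt0.
split=> H i => [z y im y01 zE|im I J z zI].
  have w0 := cyl_width (leaf_word (src p) i).
  have w1 := cyl_width (leaf_word (tgt p) (ident p i)).
  have := H i im z; rewrite !E //= zE => ->; last by rewrite (cyl_affine _ y); nra.
  rewrite -/(ident p i) !(cyl_affine _ y); field; lra.
move: @I @J zI; rewrite !E //= -[sval z]/(val z) => zI.
have w0 := cyl_width (leaf_word (src p) i).
pose y := (val z - cyl (leaf_word (src p) i) 0) /
          (cyl (leaf_word (src p) i) 1 - cyl (leaf_word (src p) i) 0).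
rewrite (H i z y) //; last 2 first.
- by rewrite /y ler_pdivlMr // ltr_pdivrMr //; lra.
- by rewrite [RHS]cyl_affine /y; field; lra.
by rewrite -/(ident p i) [LHS]cyl_affine /y; field; lra.
Qed.

Lemma maps_leaves_thompson f s t k : nleaves t = nleaves s ->
  maps_leaves f s t k -> exists p, [/\ src p = s, tgt p = t & represents p f].
Proof.
move=> ts H; have s0 := nleaves_gt0 s.
have kP : (1 <= (k %% nleaves s).+1 <= nleaves s)%N by rewrite ltn_mod.
exists (TreeTriple ts kP); split=> //; apply/representsE => i z y im y01 zE /=.
by rewrite modnDmr; apply: H.
Qed.

(** The halves of a leaf interval go to the corresponding halves of its image. From right to left
    this refines a triple, from left to right it cancels a caret. *)
Lemma maps_leaves_expand f s t k i : nleaves t = nleaves s ->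
  (i < nleaves s)%N -> (k < nleaves s)%N ->
  maps_leaves f (expand s i) (expand t ((i + k) %% nleaves s))
    (if (i + k < nleaves s)%N then k else k.+1)
  <-> maps_leaves f s t k.
Proof.
move=> ts im km.
have [sh0 sh1 shn] := shift_expand im km.
set j := ((i + k) %% _)%N in sh0 sh1 shn *; set k' := (if _ then _ else _) in sh0 sh1 shn *.
have m0 := nleaves_gt0 s.
have lt_t a : ((a + k) %% nleaves s < nleaves t)%N by rewrite ts ltn_mod.
have [s0 s1 sn] := leaf_word_expandE im.
have [t0 t1 tn] := leaf_word_expandE (lt_t i).
split=> H a z y; rewrite ?nleaves_expand => am y01 zE.
  have [ai|ai] := eqVneq a i; last first.
    have [jn e] := shn a ai am.
    by rewrite -tn // -e -(nleaves_expand s i); apply: H;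
      rewrite ?nleaves_expand ?sn // /bump; lia.
  (* The point lies in the left half with coordinate [2 * y], or in the right half with coordinate
     [2 * y - 1]. *)
  rewrite ai -/j; case: (ltrP y (1 / 2)) => y2.
    have := H i z (2 * y); rewrite nleaves_expand sh0 s0 t0 => ->; rewrite ?zE ?ai.
    - by rewrite -cats1 cyl_cat /=; congr cyl; field.
    - lia.
    - lra.
    - by rewrite -cats1 cyl_cat /=; congr cyl; field.
  have := H i.+1 z (2 * y - 1); rewrite nleaves_expand sh1 s1 t1 => ->; rewrite ?zE ?ai.
  - by rewrite -cats1 cyl_cat /=; congr cyl; field.
  - lia.
  - lra.
  - by rewrite -cats1 cyl_cat /=; congr cyl; field.
have y01' (b : bool) : 0 <= (b%:R + y) / 2 < 1 by case: b => /=; lra.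
have [ai|ai] := eqVneq a i.
  rewrite ai sh0 t0 -cats1 cyl_cat; apply: H => //=; first exact: (y01' false).
  by rewrite zE ai s0 -cats1 cyl_cat.
have [ai1|ai1] := eqVneq a i.+1.
  rewrite ai1 sh1 t1 -cats1 cyl_cat; apply: H => //=; first exact: (y01' true).
  by rewrite zE ai1 s1 -cats1 cyl_cat.
have [b [ab bi bm]] : exists b, [/\ a = bump i.+1 b, b != i & (b < nleaves s)%N].
  by exists (unbump i.+1 a); rewrite /bump /unbump; split; lia.
have [jn e] := shn b bi bm.
rewrite ab e tn //; apply: H => //.
by rewrite zE ab sn.
Qed.

End Thompson.

(** * Common refinements of trees *)

(** One caret at a time, so that [maps_leaves_expand] can be iterated. *)
Inductive refines : btree -> btree -> Prop :=
| refines_refl t : refines t t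
| refines_expand s t i : (i < nleaves s)%N -> refines (expand s i) t ->
    refines s t.

Lemma refines_trans s t r : refines s t -> refines t r -> refines s r.
Proof. by elim=> // {}s {}t i ? _ IH /IH; apply: refines_expand. Qed.

Lemma refines_node l l' r r' : refines l l' -> refines r r' ->
  refines (Node l r) (Node l' r').
Proof.
move=> ll rr; apply: (@refines_trans _ (Node l' r)).
  elim: ll => [t|s t i si _ IH]; first exact: refines_refl.
  by apply: (@refines_expand _ _ i); rewrite /= ?si // ltn_addr.
elim: rr => [t|s t i si _ IH]; first exact: refines_refl.
apply: (@refines_expand _ _ (nleaves l' + i)) => /=; first by rewrite ltn_add2l.
by rewrite ltnNge leq_addr addKn.
Qed.

Lemma refines_leaf t : refines Leaf t.
Proof.
elim: t => [|l IHl r IHr]; first exact: refines_refl.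
by apply: (@refines_expand _ _ 0) => //; apply: refines_node.
Qed.

Lemma common_refinement s t : exists r, refines s r /\ refines t r.
Proof.
elim: s t => [|l IHl r IHr] t; first by exists t; split; [exact: refines_leaf|exact: refines_refl].
case: t => [|l' r']; first by exists (Node l r); split; [exact: refines_refl|exact: refines_leaf].
have [l2 [? ?]] := IHl l'; have [r2 [? ?]] := IHr r'.
by exists (Node l2 r2); split; apply: refines_node.
Qed.

(** * Group structure of T and existence of reduced triples *)

Section ThompsonGroup.
Variable R : realType.
Implicit Types (f g : circle_perm R) (u w : seq bool) (x y : R) (z : circle R).

Lemma maps_leaves_refine f s s' t k : refines s s' -> nleaves t = nleaves s ->
  maps_leaves f s t k ->
  exists t' k', nleaves t' = nleaves s' /\ maps_leaves f s' t' k'.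
Proof.
move=> ss; elim: ss t k => [r|r r' i ri _ IH] t k tr H; first by exists t, k.
have kr : (k %% nleaves r < nleaves r)%N by rewrite ltn_mod nleaves_gt0.
have H' : maps_leaves f r t (k %% nleaves r).
  by move=> a z y ar y01 zE; rewrite modnDmr; apply: H.
have /IH := (maps_leaves_expand f tr ri kr).2 H'; apply.
by rewrite !nleaves_expand tr.
Qed.

Lemma maps_leaves_inv f s t k : nleaves t = nleaves s ->
  maps_leaves f s t k ->
  maps_leaves (f^-1)%g t s (nleaves s - k %% nleaves s).
Proof.
move=> ts H j z y; rewrite ts => js y01 zE.
set i := ((j + _) %% _)%N.
have im : (i < nleaves s)%N by rewrite ltn_mod nleaves_gt0.
pose x : circle R := exist (fun x => is_true (0 <= x < 1)) _
  (cyl_ge0_lt1 (leaf_word s i) y01).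
suff -> : z = f x by rewrite /= cp_funK.
by apply: val_inj; rewrite (H i x y) // modn_shiftK.
Qed.

Lemma thompson1 : thompson_T (1%g : circle_perm R).
Proof.
have H : maps_leaves (1%g : circle_perm R) Leaf Leaf 0 by case.
by have [p [_ _ ?]] := maps_leaves_thompson (erefl : nleaves Leaf = nleaves Leaf) H; exists p.
Qed.

Lemma thompsonV f : thompson_T f -> thompson_T (f^-1)%g.
Proof.
case=> p /representsE /(maps_leaves_inv (nleaves_tgt p)) H.
have [q [_ _ ?]] := maps_leaves_thompson (esym (nleaves_tgt p)) H.
by exists q.
Qed.

Lemma thompsonM f g : thompson_T f -> thompson_T g -> thompson_T (f * g)%g.
Proof.
case=> p /representsE Hp [q /representsE Hq].
(* [f] is rewritten with source tree [r] and, by way of its inverse, [g] with target tree [r]; the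
   leaf maps then compose. *)
have [r [pr qr]] := common_refinement (src p) (tgt q).
have [t [k [tr H]]] := maps_leaves_refine pr (nleaves_tgt p) Hp.
have [s [l [sr H']]] := maps_leaves_refine qr (esym (nleaves_tgt q))
  (maps_leaves_inv (nleaves_tgt q) Hq).
have {H'} := maps_leaves_inv sr H'; rewrite invgK; set l' := (_ - _)%N => H'.
suff H2 : maps_leaves (f * g)%g s t (l' + k).
  have [|? [_ _ ?]] := maps_leaves_thompson _ H2; first by rewrite tr sr.
  by eexists; eassumption.
move=> i z y im y01 zE; have rm : (0 < nleaves r)%N := nleaves_gt0 r.
rewrite addnA -modnDml sr; apply: H => //; first by rewrite ltn_mod.
by rewrite -sr; apply: H'.
Qed.

(** Induction on the number of leaves: cancelling two identified carets leaves a smaller triple for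
    [f]. *)
Lemma reduced_triple f : thompson_T f -> exists p, represents p f /\ reduced p.
Proof.
case=> p; have [n] := ubnP (nleaves (src p)); elim: n p => // n IH p pn pf.
have [|nred] := pselect (reduced p); first by exists p.
have [i [j [ip jp ij ij1]]] := contrapT nred.
have [s [i' [/= iE im sE]]] := leaf_caretsP ip; rewrite add0n in iE; subst i'.
have [t [j' [/= jE jm tE]]] := leaf_caretsP jp; rewrite add0n in jE; subst j'.
have := nleaves_tgt p; rewrite tE sE !nleaves_expand => -[ts].
have /andP[k0 km] := shift_bounds p; rewrite sE nleaves_expand in km.
rewrite /ident sE nleaves_expand in ij ij1.
move/representsE: pf; rewrite sE tE.
set k := (shift p).-1 in ij ij1 *; have {}km : (k <= nleaves s)%N by rewrite /k; lia.
(* Inverse of the rule in [shift_expand]: the shift drops by one exactly when leaf [i] wraps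
   around. *)
pose k' := if (i + k <= nleaves s)%N then k else k.-1.
(* Without wrapping, [k = nleaves s] would force [i = 0]; leaf 1 would then go to 0, against
   [ij1]. *)
have km' : (k' < nleaves s)%N.
  rewrite /k'; case: ifP => ?; last by lia.
  by move: ij1; rewrite modn_lt2; [|lia]; case: ifP; lia.
have ijs : ((i + k') %% nleaves s)%N = j.
  rewrite modn_lt2; last by lia.
  move: ij; rewrite modn_lt2 /k'; last by lia.
  by case: (leqP (i + k)%N (nleaves s)) => ?; case: ifP => ?; case: ifP; lia.
have kE : (if (i + k' < nleaves s)%N then k' else k'.+1) = k.
  move: ij; rewrite modn_lt2 /k'; last by lia.
  by case: (leqP (i + k)%N (nleaves s)) => ?; case: ifP => ?; case: ifP; lia.
rewrite -ijs -kE => /(maps_leaves_expand f ts im km').1 H.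
have [q [sq _ qf]] := maps_leaves_thompson ts H.
by apply: (IH q) => //; rewrite sq; move: pn; rewrite sE nleaves_expand.
Qed.

End ThompsonGroup.

(** * Digit parity of dyadic points and membership in [vec_T] *)

Section Dyadic.
Variable R : realType.
Implicit Types (f g h : circle_perm R) (u w : seq bool) (x y : R) (z : circle R).

Lemma cyl0_ge0_lt1 w : 0 <= cyl w (0 : R) < 1.
Proof. by apply: cyl_ge0_lt1; lra. Qed.

(** Two finite expansions of the same number differ only by trailing zeros. *)
Lemma cyl0_parity u w : cyl u 0 = cyl w 0 :> R -> parity u = parity w.
Proof.
have aux v : 0 = cyl v 0 :> R -> parity v = false.
  elim: v => //= b v IH e; have := cyl0_ge0_lt1 v.
  by case: b e => /= e vP; [lra|apply: IH; lra].
elim: u w => [|b u IH] [|c w] //=; first by move/(aux (c :: w)).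
  by move/esym/(aux (b :: u)).
have := cyl0_ge0_lt1 u; have := cyl0_ge0_lt1 w.
case: b; case: c => /= wP uP e; first by congr (~~ _); apply: IH; lra.
- by lra.
- by lra.
- by apply: IH; lra.
Qed.

Definition dyadic z : Prop := exists w, val z = cyl w 0.

(** Well defined by [cyl0_parity]; false off the dyadic points. *)
Definition digit_parity z : bool := `[< exists w, val z = cyl w 0 /\ parity w >].

Lemma digit_parityE z w : val z = cyl w 0 -> digit_parity z = parity w.
Proof.
move=> zw; apply/asboolP/idP => [[v [zv pv]]|]; last by exists w.
by rewrite -(@cyl0_parity v w) // -zv.
Qed.

(** Follow [w] down the tree, padding it with zeros if it ends before a leaf. *)
Lemma leaf_prefix t w :
  exists i v, (i < nleaves t)%N /\ cyl w 0 = cyl (leaf_word t i ++ v) 0 :> R.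
Proof.
elim: t w => [|l IHl r IHr] w; first by exists 0%N, w.
have left v : cyl w 0 = cyl (false :: v) 0 :> R -> exists i v, (i < nleaves (Node l r))%N /\
    cyl w 0 = cyl (leaf_word (Node l r) i ++ v) 0 :> R.
  move=> ->; have [i [v' [il e]]] := IHl v.
  by exists i, v'; rewrite /= il /= e ltn_addr.
case: w left => [|[] w] left; last exact: left.
  by apply: (left [::]) => /=; lra.
have [i [v [ir e]]] := IHr w; exists (nleaves l + i)%N, v.
by rewrite /= ltn_add2l ir ltnNge leq_addr addKn /= e.
Qed.

(** [f] replaces the leaf prefix and keeps the tail [v], so the change of digit parity depends only
    on the leaf. *)
Lemma maps_leaves_dyadic f s t k z : maps_leaves f s t k -> dyadic z ->
  exists i v, [/\ (i < nleaves s)%N, val z = cyl (leaf_word s i ++ v) 0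
    & val (f z) = cyl (leaf_word t ((i + k) %% nleaves s) ++ v) 0].
Proof.
move=> H [w zw]; have [i [v [im e]]] := leaf_prefix s w.
exists i, v; split=> //; first by rewrite zw.
by rewrite cyl_cat; apply: H => //; rewrite ?cyl0_ge0_lt1 // -cyl_cat zw.
Qed.

Lemma thompson_dyadic f z : thompson_T f -> dyadic z -> dyadic (f z).
Proof.
case=> p /representsE /maps_leaves_dyadic H /H [i [v [_ _ e]]].
by exists (leaf_word (tgt p) ((i + (shift p).-1) %% nleaves (src p)) ++ v).
Qed.

Definition circle_pt (x : R) (x01 : 0 <= x < 1) : circle R :=
  exist (fun x => is_true (0 <= x < 1)) x x01.

(** The right-hand condition speaks of [f] alone, so bipartiteness does not depend on the
    representing triple. *)
Lemma bipartite_digit_parity p f : represents p f ->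
  bipartite (@thompson_graph p) <->
  exists c, forall z, dyadic z -> digit_parity (f z) = digit_parity z (+) c.
Proof.
move=> /representsE H; split=> [/bipartite_parity [c cP]|[c cP]].
  exists c => z /(maps_leaves_dyadic H) [i [v [im e1 e2]]].
  rewrite (digit_parityE e1) (digit_parityE e2) !parity_cat [parity _]cP //.
  by rewrite addbAC.
apply/bipartite_parity; exists c => i im.
pose z := circle_pt (cyl0_ge0_lt1 (leaf_word (src p) i)).
have zE : val z = cyl (leaf_word (src p) i) 0 by [].
have := cP z; rewrite (digit_parityE zE).
rewrite (@digit_parityE _ (leaf_word (tgt p) (ident p i))); first by apply; eexists.
by apply: H => //; lra.
Qed.

Lemma vec_TP f : vec_T f <-> thompson_T f /\
  exists c, forall z, dyadic z -> digit_parity (f z) = digit_parity z (+) c.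
Proof.
split=> [[p [pf _ /(bipartite_digit_parity pf)]]|[/reduced_triple [p [pf pred]] H]].
  by split=> //; exists p.
by exists p; split=> //; apply/(bipartite_digit_parity pf).
Qed.

Lemma vec_T1 : vec_T (1%g : circle_perm R).
Proof. by apply/vec_TP; split; [exact: thompson1|exists false => z; rewrite addbF]. Qed.

Lemma vec_TV f : vec_T f -> vec_T (f^-1)%g.
Proof.
move=> /vec_TP[/thompsonV Tf [c cP]]; apply/vec_TP; split=> //; exists c => z zd.
by rewrite -{2}(cp_invK f z) cP ?addbK //; exact: (thompson_dyadic Tf zd).
Qed.

Lemma vec_TM f g : vec_T f -> vec_T g -> vec_T (f * g)%g.
Proof.
move=> /vec_TP[Tf [c cP]] /vec_TP[Tg [d dP]]; apply/vec_TP.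
split; first exact: thompsonM; exists (d (+) c) => z zd /=.
by rewrite cP ?dP ?addbA //; apply: thompson_dyadic.
Qed.

Lemma vec_TX f n : vec_T f -> vec_T (f ^+ n)%g.
Proof.
move=> Vf; elim: n => [|n IH]; first by rewrite expg0; exact: vec_T1.
by rewrite expgS; apply: vec_TM.
Qed.

(* 0 -> 00, 10 -> 010, 110 -> 011, 111 -> 1 on leaf addresses: in each pair the
   two digit sums have the same parity. *)
Definition pull_fun z : R :=
  let x := val z in
  if x < 3 / 4 then x / 2 else if x < 7 / 8 then x - 3 / 8 else 4 * x - 3.

Definition pull_inv z : R :=
  let x := val z in
  if x < 3 / 8 then 2 * x else if x < 1 / 2 then x + 3 / 8 else (x + 3) / 4.

Lemma pull_fun01 z : 0 <= pull_fun z < 1.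
Proof.
by rewrite /pull_fun; case: z => x /= x01; do 2?[case: ltrP => ?]; lra.
Qed.

Lemma pull_inv01 z : 0 <= pull_inv z < 1.
Proof.
by rewrite /pull_inv; case: z => x /= x01; do 2?[case: ltrP => ?]; lra.
Qed.

Lemma pull_funK : cancel (fun z => circle_pt (pull_fun01 z))
                         (fun z => circle_pt (pull_inv01 z)).
Proof.
move=> z; apply: val_inj => /=; rewrite /pull_inv /= /pull_fun.
case: z => x /= x01.
by case: (ltrP x (3 / 4)) => ?; [|case: (ltrP x (7 / 8)) => ?];
  do 2?[case: ltrP => ?]; lra.
Qed.

Lemma pull_invK : cancel (fun z => circle_pt (pull_inv01 z))
                         (fun z => circle_pt (pull_fun01 z)).
Proof.
move=> z; apply: val_inj => /=; rewrite /pull_fun /= /pull_inv.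
case: z => x /= x01.
by case: (ltrP x (3 / 8)) => ?; [|case: (ltrP x (1 / 2)) => ?];
  do 2?[case: ltrP => ?]; lra.
Qed.

Definition pull : circle_perm R := CirclePerm pull_funK pull_invK.

Definition pull_src : btree := Node Leaf (Node Leaf (Node Leaf Leaf)).
Definition pull_tgt : btree := Node (Node Leaf (Node Leaf Leaf)) Leaf.

Lemma pull_vec_T : vec_T pull.
Proof.
have H : maps_leaves pull pull_src pull_tgt 0.
  move=> i z y im y01 zE; rewrite -[val (pull z)]/(pull_fun z) /pull_fun zE.
  rewrite addn0 modn_small //.
  case: i im {zE} => [|[|[|[|i]]]] //= _;
    by case: ltrP => ?; [|case: ltrP => ?]; lra.
have [p [_ _ pf]] :=
  maps_leaves_thompson (erefl : nleaves pull_tgt = nleaves pull_src) H.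
apply/vec_TP; split; first by exists p.
exists false => z /(maps_leaves_dyadic H) [i [v [im e1 e2]]].
rewrite (digit_parityE e1) (digit_parityE e2) !parity_cat addn0 modn_small // addbF.
by congr addb; case: i im {e1 e2} => [|[|[|[|i]]]].
Qed.

End Dyadic.

(** * Attraction of dyadic points to 0 under [pull] *)

Section Pull.
Variable R : realType.
Implicit Types (f g h t : circle_perm R) (z : circle R).

Lemma expg_iter f n z : (f ^+ n)%g z = iter n f z.
Proof. by elim: n => [|n IH]; rewrite ?expg0 // expgS iterS -IH. Qed.

Lemma pull_val z : val (pull R z) = pull_fun z.
Proof. by []. Qed.

Lemma iter_pull_le m n z : (m <= n)%N ->
  val (iter n (pull R) z) <= val (iter m (pull R) z).
Proof.
move=> /subnK <-; elim: (n - m)%N => // k; apply: le_trans.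
rewrite addSn iterS pull_val /pull_fun.
by case: (iter _ _ _) => x /= x01; do 2?[case: ltrP => ?]; lra.
Qed.

(** On [7/8, 1) the map is [4 * x - 3], which multiplies the distance to 1 by four. *)
Lemma pull_escape m z : (1 / 4) ^+ m <= 1 - val z ->
  exists n, val (iter n (pull R) z) < 7 / 8.
Proof.
elim: m z => [|m IH] z; first by rewrite expr0 => zm; exists 0%N; move: zm; case: z => x /=; lra.
rewrite exprS => zm; have [z7|z7] := ltrP (val z) (7 / 8); first by exists 0%N.
have [|n] := IH (pull R z); last by rewrite -iterSr => ?; exists n.+1.
rewrite pull_val /pull_fun; case: z z7 zm => x /= x01 x7 xm.
by do 2?[case: ltrP => ?]; lra.
Qed.

(** Below 7/8 each step multiplies by at most 4/7, and two steps more than halve a positive value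
    because 16/49 < 1/2. *)
Lemma pull_attract m z : val z < 7 / 8 ->
  exists n, val (iter n (pull R) z) < (1 / 2) ^+ m.
Proof.
move=> z7; elim: m => [|m [n IH]].
  by exists 0%N; rewrite expr0; case: z {z7} => x /= /andP[].
have aux z' : val z' < 7 / 8 -> val (pull R z') <= 4 / 7 * val z'.
  rewrite pull_val /pull_fun; case: z' => x /= x01 x7.
  by do 2?[case: ltrP => ?]; lra.
exists n.+2; rewrite !iterS exprS; move: IH.
have : val (iter n (pull R) z) < 7 / 8 := le_lt_trans (iter_pull_le z (leq0n n)) z7.
move: (iter n _ z) => z' z'7 IH.
have z'0 : 0 <= val z' by case: z' {IH z'7} => x /= /andP[].
have le1 := aux _ z'7; have le2 := aux (pull R z'); lra.
Qed.

(** A dyadic number with n digits is at most 1 - 2^-n; powers of 1/4 match the rate in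
    [pull_escape]. *)
Lemma dyadic_lt1 z : dyadic z -> exists m, (1 / 4) ^+ m <= 1 - val z.
Proof.
case=> w ->; exists (size w); elim: w => [|b w IH] /=; first by rewrite expr0; lra.
have : (0 : R) <= (1 / 4) ^+ size w by apply: exprn_ge0; lra.
by rewrite exprS; case: b => /=; lra.
Qed.

Lemma pull_tends_to0 m z : dyadic z ->
  exists N, forall n, (N <= n)%N -> val (iter n (pull R) z) < (1 / 2) ^+ m.
Proof.
move=> /dyadic_lt1 [k /pull_escape [a /(pull_attract m) [b]]].
rewrite -iterD => ab; exists (b + a)%N => n nab.
exact: le_lt_trans (iter_pull_le z nab) ab.
Qed.

Lemma dyadic_near0 w m : cyl w 0 < (1 / 2) ^+ m :> R ->
  exists v, cyl w 0 = cyl (nseq m false ++ v) 0 :> R.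
Proof.
elim: m w => [|m IH] [|b w] /=; first by exists [::].
- by exists (b :: w).
- by move=> _; exists [::]; elim: m {IH} => /= [|m <-]; lra.
- have wP := @cyl0_ge0_lt1 R w; rewrite exprS => lt.
  have : ((1 / 2) ^+ m : R) <= 1 by apply: exprn_ile1; lra.
  move: lt; case: b => /= lt le1; first by lra.
  by have [|v ->] := IH w; [lra|exists v].
Qed.

(** Near 0 only the leftmost leaf matters. Its address is all zeros, so [c] is the parity of the
    address of its image. *)
Lemma digit_parity_near0 g : thompson_T g ->
  exists c m, forall z, dyadic z -> val z < (1 / 2) ^+ m ->
    digit_parity (g z) = digit_parity z (+) c.
Proof.
case=> p /representsE H; set u := leaf_word (src p) 0.
exists (parity (leaf_word (tgt p) ((0 + (shift p).-1) %% nleaves (src p)))), (size u).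
move=> z [w zw]; rewrite zw => /dyadic_near0 [v].
rewrite -leaf_word0 -zw => zv.
rewrite (digit_parityE zv) parity_cat [leaf_word (src p) 0]leaf_word0 parity_nseq.
rewrite addbC -parity_cat; apply: digit_parityE.
rewrite cyl_cat; apply: H (nleaves_gt0 _) (cyl0_ge0_lt1 _ _) _.
by rewrite -cyl_cat.
Qed.

End Pull.

(** * Cosets and finite index *)

Section FiniteIndex.
Local Open Scope classical_set_scope.
Local Open Scope group_scope.

(** Pigeonhole: two of the cosets [F n] coincide, and the quotient of the two powers lies in [K]. *)
Lemma finite_index_expg (G : groupType) (H K : set G) (h : G) :
  finite_index H K -> K 1 -> (forall n, H (h ^+ n)) ->
  exists n, K (h ^+ n.+1).
Proof.
move=> fHK K1 Hh.
pose F n := [set h ^+ n * k | k in K].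
have Fn n : F n (h ^+ n) by exists 1; rewrite ?mulg1.
have [Finj|] := pselect (injective F).
  case: infinite_nat; rewrite -(_ : F @^-1` range F = setT); last first.
    by apply/seteqP; split=> // n _; exists n.
  apply: finite_preimage; first by move=> ? ? _ _; apply: Finj.
  by apply: sub_finite_set fHK => _ [n _ <-]; exists (h ^+ n).
move=> /existsNP [m /existsNP [n /not_implyP [mn /eqP]]].
wlog lt_mn : m n mn / (m < n)%N.
  move=> W nmn; have /orP[lt|lt] : (m < n)%N || (n < m)%N by rewrite -neq_ltn.
    exact: (W m n).
  by apply: (W n m) => //; rewrite eq_sym.
(* Since [K] contains 1, [h ^+ n] lies in its own coset, hence in that of [h ^+ m]. *)
move=> _; have [k Kk kE] : F m (h ^+ n) by rewrite mn.
exists (n - m).-1; rewrite prednK ?subn_gt0 //.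
have e : h ^+ n = h ^+ m * h ^+ (n - m) by rewrite -expgnDr subnKC // ltnW.
by move: kE; rewrite e => /mulgI <-.
Qed.

Lemma finite_index_refl (G : groupType) (H : set G) :
  H 1 -> (forall x y, H x -> H y -> H (x * y)) -> (forall x, H x -> H x^-1) ->
  finite_index H H.
Proof.
move=> H1 HM HV; apply: (@sub_finite_set _ _ [set H]); last exact: finite_set1.
move=> _ [h Hh <-]; apply/seteqP; split=> [_ [k Hk <-]|k Hk]; first exact: HM.
by exists (h^-1 * k); [apply: HM => //; apply: HV|rewrite mulVKg].
Qed.

End FiniteIndex.

(** * The commensurator of [vec_T] *)

Theorem corollary5 (R : realType) :
  commensurator (@thompson_T R) (@vec_T R) = @vec_T R.
Proof.
apply/seteqP; split=> t.
  case=> Tt [fi _].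
  have Tt' := thompsonV Tt.
  have [|n [[g Vg gE] _]] := finite_index_expg fi _ (fun n => vec_TX n (@pull_vec_T R)).
    by split; [exists 1%g; rewrite ?mulg1 ?mulgV //|]; exact: vec_T1.
  set h := (pull R ^+ n.+1)%g in gE.
  have /vec_TP[Tg [c cP]] := Vg.
  have /vec_TP[Th [c' hP]] := vec_TX n.+1 (@pull_vec_T R).
  rewrite -/h in Th hP.
  have iter_hE k z : iter k h z = iter (k * n.+1) (pull R) z.
    by rewrite -!expg_iter -expgnA mulnC.
  have iter_dyadic k z : dyadic z -> dyadic (iter k h z).
    by move=> zd; elim: k => //= k; apply: thompson_dyadic.
  pose d z := digit_parity ((t^-1)%g z) (+) digit_parity z.
  have dh z : dyadic z -> d (h z) = d z (+) (c (+) c').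
    (* [t^-1] intertwines [h] and [g], so [h] changes [d] by the sum of their two parity
       constants. *)
    have thE : (t^-1 * h = g * t^-1)%g by rewrite -gE -!mulgA mulKg.
    move=> zd; rewrite /d hP // -[(t^-1)%g (h z)]/((t^-1 * h)%g z) thE.
    rewrite -[(g * t^-1)%g z]/(g ((t^-1)%g z)) cP; last exact: thompson_dyadic.
    by rewrite addbACA.
  (* Evaluate [dh] at the fixed point 0 of [h]. *)
  have cc' : c (+) c' = false.
    pose z0 : circle R := circle_pt (cyl0_ge0_lt1 R [::]).
    have hz0 : h z0 = z0.
      rewrite expg_iter iter_fix //; apply: val_inj.
      by rewrite pull_val /pull_fun /=; case: ltrP; lra.
    have /dh : dyadic z0 by exists [::].
    by rewrite hz0; case: (d z0); case: (c (+) c').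
  have iter_d k z : dyadic z -> d (iter k h z) = d z.
    move=> zd; elim: k => //= k <-.
    by rewrite dh ?cc' ?addbF //; apply: iter_dyadic.
  have [c0 [m near0]] := digit_parity_near0 Tt'.
  (* Iterating [h] keeps [d] and brings [z] into the neighbourhood of 0 where [d] equals [c0]. *)
  have d_cst z : dyadic z -> d z = c0.
    move=> zd; have [N lt_m] := pull_tends_to0 m zd.
    rewrite -(iter_d N z zd) /d near0; first by rewrite addbAC addbb.
    - exact: iter_dyadic.
    - by rewrite iter_hE; apply: lt_m; rewrite leq_pmulr.
  apply/vec_TP; split=> //; exists c0 => z zd.
  (* Evaluating [d] at [t z] turns the statement about [t^-1] into one about [t]. *)
  rewrite -(d_cst (t z)); last exact: thompson_dyadic.
  rewrite /d -[(t^-1)%g (t z)]/(((t^-1 * t)%g : circle_perm R) z) mulVg /=.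
  by rewrite addbA addbb.
move=> Vt; have [Tt _] := (vec_TP t).1 Vt.
(* Conjugation by an element of the subgroup preserves it, so both indices are 1. *)
have VtE : conj_set t (@vec_T R) = @vec_T R.
  apply/seteqP; split=> [_ [h Vh <-]|h Vh].
    by apply: vec_TM; [exact: vec_TM|exact: vec_TV].
  exists (t^-1 * h * t)%g; last by rewrite !mulgA mulgV mul1g mulgK.
  by apply: vec_TM => //; apply: vec_TM => //; apply: vec_TV.
split=> //; rewrite VtE setIid.
split; apply: finite_index_refl;
  [exact: vec_T1|exact: vec_TM|exact: vec_TV|exact: vec_T1|exact: vec_TM|exact: vec_TV].
Qed.
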